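(* Let $Q$ be a finite extra loop with nucleus $N(Q)$, and suppose $|N(Q)| = p^m r$, where $p$ is prime and $p \nmid r$. Then: 1. $|\mathrm{Syl}_p(Q)| = 1 + kp$ for some integer $k \ge 0$, where $1 + kp \mid r$. 2. If $S$ is a $p$-subloop of $Q$, then there exists $P \in \mathrm{Syl}_p(Q)$ containing $S$. 3. If $P_1, P_2 \in \mathrm{Syl}_p(Q)$, then there exists $x \in N(Q)$ such that $P_1 T_x = P_2$, so that $P_1$ and $P_2$ are isomorphic.
   Context: A loop is a set with a binary operation having a two-sided identity $1$ and such that for all $a,b$ the equations $ax=b$ and $ya=b$ have unique solutions. In products, juxtaposition binds more tightly than $\cdot$ (so $xy\cdot z=(xy)z$). An extra loop is a loop that is both conjugacy closed and Moufang; equivalently (and this may be taken as the definition) a loop satisfying the identity $(xy\cdot z)\cdot x = x\cdot(y\cdot zx)$. The nucleus $N(Q)$ is the set of $a\in Q$ that associate with all pairs of elements in every position: $a\cdot xy=ax\cdot y$, $x\cdot ay=xa\cdot y$, $x\cdot ya=xy\cdot a$ for all $x,y\in Q$. Maps are written on the right: $xy = xR_y = yL_x$ defines the translations $R_y, L_x$, and $T_x := R_x L_x^{-1}$ (apply $R_x$ first), so $yT_x$ is the unique $w$ with $xw = yx$. A $p$-subloop is a subloop whose order is a power of $p$ (including $1$). If $p^{i}$ is the exact power of $p$ dividing $|Q|$, a Sylow $p$-subloop of $Q$ is a subloop of order $p^{i}$, and $\mathrm{Syl}_p(Q)$ is the set of all Sylow $p$-subloops of $Q$. *)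

(* Defs.v *)
From HB Require Import structures.
From mathcomp Require Import all_boot.

Set Implicit Arguments.
Unset Strict Implicit.
Unset Printing Implicit Defensive.

Local Open Scope group_scope.

HB.mixin Record UMagma_isLoop Q of UMagma Q := {
  ldiv_unique : forall a b : Q, exists! x : Q, a * x = b;
  rdiv_unique : forall a b : Q, exists! y : Q, y * a = b
}.

#[short(type="loopType")]
HB.structure Definition Loop := {Q of UMagma_isLoop Q & UMagma Q}.

#[short(type="finLoopType")]
HB.structure Definition FinLoop := {Q of Loop Q & Finite Q}.

Section LoopDivision.
Variable Q : loopType.
Implicit Types a b x y : Q.

Fact ldiv_exists a b : exists x, a * x == b.
Proof. by have [x [abx _]] := ldiv_unique a b; exists x; apply/eqP. Qed.

Fact rdiv_exists a b : exists y, y * a == b.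
Proof. by have [y [aby _]] := rdiv_unique a b; exists y; apply/eqP. Qed.

(* The element written a \ b, so that ldiv a is the inverse of L_a. *)
Definition ldiv a b : Q := xchoose (ldiv_exists a b).

(* The element written b / a, so that rdiv a is the inverse of R_a;
   the divisor comes first. *)
Definition rdiv a b : Q := xchoose (rdiv_exists a b).

Lemma mul_ldiv a b : a * ldiv a b = b.
Proof. exact/eqP/(xchooseP (ldiv_exists a b)). Qed.

Lemma mul_rdiv a b : rdiv a b * a = b.
Proof. exact/eqP/(xchooseP (rdiv_exists a b)). Qed.

Lemma loop_mulI a : injective (fun x => a * x).
Proof.
move=> x y /= eq_axy; have [z [_ uz]] := ldiv_unique a (a * y).
by rewrite -(uz x eq_axy) -(uz y erefl).
Qed.

Lemma loop_mulIr a : injective (fun x => x * a).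
Proof.
move=> x y /= eq_xya; have [z [_ uz]] := rdiv_unique a (y * a).
by rewrite -(uz x eq_xya) -(uz y erefl).
Qed.

(* The map T_x = R_x L_x^-1, maps being composed from left to right. *)
Definition loopT x y : Q := ldiv x (y * x).

Lemma mul_loopT x y : x * loopT x y = y * x.
Proof. exact: mul_ldiv. Qed.

End LoopDivision.

Definition extra_loop (Q : loopType) : Prop :=
  forall x y z : Q, ((x * y) * z) * x = x * (y * (z * x)).

Definition nucleus (Q : finLoopType) : {set Q} :=
  [set a | [forall x, forall y,
     [&& a * (x * y) == (a * x) * y,
         x * (a * y) == (x * a) * y
       & x * (y * a) == (x * y) * a]]].

Definition subloop (Q : finLoopType) (S : {set Q}) : bool :=
  (1 \in S) &&
  [forall a in S, forall b in S,
     [&& a * b \in S, ldiv a b \in S & rdiv a b \in S]].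

Definition p_subloop (p : nat) (Q : finLoopType) (S : {set Q}) : bool :=
  subloop S && p.-nat #|S|.

Definition Syl (p : nat) (Q : finLoopType) : {set {set Q}} :=
  [set P : {set Q} | subloop P & #|P| == (#|Q|`_p)%N].

Definition subloop_isog (Q Q' : finLoopType) (A : {set Q}) (B : {set Q'}) :
    Prop :=
  exists f : Q -> Q',
    [/\ {in A &, injective f}, f @: A = B
      & {in A &, {morph f : x y / x * y >-> x * y}}].

(* Main.v *)
From HB Require Import structures.
From mathcomp Require Import all_boot all_fingroup all_solvable.
Require Import Defs.

Set Implicit Arguments.
Unset Strict Implicit.
Unset Printing Implicit Defensive.

Local Open Scope group_scope.

(** The Sylow theory of an extra loop [Q] is that of a group obtained from [Q]
    by factoring out a small nuclear subgroup.

    An extra loop has the inverse property, so the extra law is an autotopism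
    whose components may be permuted; this yields both conjugacy closed laws
    ([cc_left], [cc_right]) and the Moufang law, and then that every square is
    nuclear ([sq_nucleus]).  Hence the nucleus [N] is normal and [Q/N] is an
    elementary abelian 2-group.

    Write [(xy)z = x(yz) . a] with [a = assoc x y z].  As [a] lies in [N] and
    depends only on the classes of [x], [y], [z] modulo [N], replacing [z] by
    [zn] shows that [a] commutes with every [n] in [N].  The two conjugacy
    closed laws make [a] symmetric in its arguments, and the extra law then
    says [x^-1 a x = a^-1].  So each of [x], [y], [z] inverts [a] by
    conjugation, and so does their product; but taking inverses in the
    equation defining [a] shows that [(xy)z] commutes with [a].  Therefore
    [a^2 = 1] ([assoc_sq]).  All associators thus lie in
    [A = {a in Z(N) | a^2 = 1}], which is a normal 2-subgroup, and [Q/A] is a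
    group.

    For [p = 2], the Sylow 2-subloops of [Q] are the preimages of the Sylow
    2-subgroups of [Q/A].  For odd [p], every [p]-subloop dies in the 2-group
    [Q/N], so it lies in the group [N].  Both cases are instances of
    [Sylow_transfer], applied to [D/B] with [(D, B)] equal to [(Q, A)] or
    [(N, 1)].  The conjugating element can be taken in [N] because the image
    of [N] has [p]-power index in [D/B], so that together with any Sylow
    [p]-subgroup it covers [D/B]; and [T_x] is an automorphism of [Q] when [x]
    is nuclear. *)

(** * The inverse property, conjugacy closedness and nuclear squares *)

Definition linv (Q : loopType) (x : Q) : Q := ldiv x 1.

Section ExtraIdentities.
Variable Q : loopType.
Hypothesis extraQ : extra_loop Q.
Implicit Types x y z a t u : Q.

Lemma ldiv_mul x y : ldiv x (x * y) = y.
Proof. by apply: (@loop_mulI _ x); rewrite mul_ldiv. Qed.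

Lemma mul_linv x : x * linv x = 1.
Proof. exact: mul_ldiv. Qed.

Lemma flexible x y : x * y * x = x * (y * x).
Proof. by have := extraQ x y 1; rewrite mulg1 mul1g. Qed.

(** Choosing [z] in the extra law with [zx = 1] gives [(xy . z)x = xy], which is
    the right inverse property for a left inverse [z] of [x]; it makes [z] a
    right inverse too. *)
Lemma mulVKr x y : y * linv x * x = y.
Proof.
have rdivK u : u * rdiv x 1 * x = u.
  by rewrite -(mul_ldiv x u) extraQ mul_rdiv mulg1.
suff -> : linv x = rdiv x 1 by [].
apply: (@loop_mulI _ x); rewrite /= mul_linv.
by apply: (@loop_mulIr _ x); rewrite /= mul1g rdivK.
Qed.

Lemma linv_mul x : linv x * x = 1.
Proof. by rewrite -{1}(mul1g (linv x)) mulVKr. Qed.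

Lemma linvK : involutive (@linv Q).
Proof.
by move=> x; apply: (@loop_mulI _ (linv x)); rewrite /= mul_linv linv_mul.
Qed.

Lemma mulKr x y : y * x * linv x = y.
Proof. by rewrite -{1}(linvK x) mulVKr. Qed.

Lemma mulVKl x y : x * (linv x * y) = y.
Proof.
by have := extraQ x (linv x) (y * linv x); rewrite mul_linv mul1g mulVKr.
Qed.

Lemma mulKl x y : linv x * (x * y) = y.
Proof. by rewrite -{2}(linvK x) mulVKl. Qed.

Lemma loopTE x y : loopT x y = linv x * (y * x).
Proof. by apply: (@loop_mulI _ x); rewrite /= mul_loopT mulVKl. Qed.

Lemma linv_uniq x y : x * y = 1 -> y = linv x.
Proof. by move=> xy1; apply: (@loop_mulI _ x); rewrite /= mul_linv. Qed.

Lemma linvM x y : linv (x * y) = linv y * linv x.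
Proof.
apply: (@loop_mulI _ y); rewrite /= mulVKl.
by rewrite -{1}(mulKl x y) mulKr.
Qed.

(** The extra law as the autotopism [(L_x^-1, R_x, T_x)].  By the inverse
    property, [(R_x, T_x, R_x)] and [(T_x, L_x^-1, L_x^-1)] are autotopisms as
    well: these are the next two lemmas, in which [t = T_x z], respectively
    [t = T_x y], is given by its defining equation. *)
Lemma extra_autotopism x y z :
  (linv x * y) * (z * x) = linv x * (y * z * x).
Proof. by rewrite -{2}(mulVKl x y) extraQ mulKl. Qed.

Lemma cc_right x y z t : x * t = z * x -> y * z * x = y * x * t.
Proof.
move=> xt; have := extra_autotopism x (linv y) (y * z).
rewrite mulKl -xt mulKl -linvM => <-.
by rewrite mulVKl.
Qed.

Lemma cc_left x y z t : x * t = y * x -> x * (t * z) = y * (x * z).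
Proof.
move=> xt; have := extra_autotopism x (y * (x * z)) (linv (x * z)).
rewrite mulKr -xt mulKl linvM mulVKr => <-.
by rewrite mulVKr mulVKl.
Qed.

(** The composite of the autotopism behind [cc_right] with the inverse of the
    one behind [cc_left]. *)
Lemma moufang x y z : (x * y) * (z * x) = x * (y * z) * x.
Proof.
pose t := loopT x z; have xt : x * t = z * x by exact: mul_loopT.
(* [cc_left] applies with [yx] in the role of [T_x(xy)]. *)
have e3 : x * (y * x * t) = (x * y) * (x * t).
  by apply: cc_left; rewrite flexible.
by rewrite -xt -e3 -(cc_right _ xt) flexible.
Qed.

(** Composing the Moufang autotopism [(L_x, R_x, L_x R_x)] with
    [extra_autotopism] cancels the first component and leaves
    [(id, R_x^2, R_x^2)]. *)
Lemma sq_right_nuclear x y z : y * z * (x * x) = y * (z * (x * x)).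
Proof.
have sqR u v : u * (v * x * x) = u * v * x * x.
  have := moufang x (linv x * u) (v * x).
  by rewrite mulVKl extra_autotopism mulVKl.
have sqr u : u * (x * x) = u * x * x by have := sqR u 1; rewrite mul1g mulg1.
by rewrite !sqr sqR.
Qed.

(** A right nuclear element [a] makes [(id, R_a, R_a)] an autotopism, and the
    inverse property permutes the components of an autotopism. *)
Lemma right_nuclear_middle a y z :
  (forall u v, u * v * a = u * (v * a)) -> y * a * z = y * (a * z).
Proof.
move=> nucR; have := nucR (y * (a * z)) (linv (a * z)).
by rewrite mulKr [in RHS]linvM mulVKr => ->; rewrite mulVKr.
Qed.

(** Right nuclearity passes to [a^-1], and inverting the products turns it into
    left nuclearity of [a]. *)
Lemma right_nuclear_left a y z :
  (forall u v, u * v * a = u * (v * a)) -> a * y * z = a * (y * z).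
Proof.
move=> nucR; have nucRV u v : u * v * linv a = u * (v * linv a).
  by rewrite -{1}(mulVKr a v) -nucR mulKr.
have := nucRV (linv z) (linv y).
by move/(congr1 (@linv Q)); rewrite !linvM !linvK.
Qed.

End ExtraIdentities.

(** * The nucleus and congruences modulo its normal subgroups *)

Definition nuclear_normal (Q : finLoopType) (B : {set Q}) : Prop :=
  [/\ B \subset nucleus Q, subloop B
    & forall x b, b \in B -> loopT x b \in B].

Definition cong (Q : finLoopType) (B : {set Q}) (x y : Q) : bool :=
  ldiv x y \in B.

Definition assoc (Q : loopType) (x y z : Q) : Q :=
  ldiv (x * (y * z)) (x * y * z).

Section Nucleus.
Variable Q : finLoopType.
Implicit Types x y z a b t u : Q.
Local Notation N := (nucleus Q).

Lemma nucleusP a :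
  reflect [/\ forall x y, a * x * y = a * (x * y),
              forall x y, x * a * y = x * (a * y)
            & forall x y, x * y * a = x * (y * a)] (a \in N).
Proof.
rewrite inE; apply: (iffP forallP) => [nuc | [nl nm nr] x].
  by split=> x y; have /forallP/(_ y)/and3P[/eqP ? /eqP ? /eqP ?] := nuc x.
by apply/forallP=> y; rewrite nl nm nr !eqxx.
Qed.

Lemma nucl a x y : a \in N -> a * x * y = a * (x * y).
Proof. by case/nucleusP. Qed.

Lemma nucm a x y : a \in N -> x * a * y = x * (a * y).
Proof. by case/nucleusP. Qed.

Lemma nucr a x y : a \in N -> x * y * a = x * (y * a).
Proof. by case/nucleusP. Qed.

Lemma nucleus1 : 1 \in N.
Proof. by apply/nucleusP; split=> x y; rewrite !(mul1g, mulg1). Qed.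

Lemma nucleusM a b : a \in N -> b \in N -> a * b \in N.
Proof.
move=> Na Nb; apply/nucleusP; split=> x y.
- by rewrite !(nucl _ _ Na) (nucl _ _ Nb).
- by rewrite -(nucm _ _ Na) (nucm _ _ Nb) (nucm _ _ Na) (nucl _ _ Na).
- by rewrite -!(nucr _ _ Nb) (nucr _ _ Na).
Qed.

Lemma loopT_inj x : injective (@loopT Q x).
Proof.
move=> y z eqT; apply: (@loop_mulIr _ x).
by rewrite /= -mul_loopT eqT mul_loopT.
Qed.

Lemma loopT_morph x : x \in nucleus Q -> {morph @loopT Q x : y z / y * z}.
Proof.
move=> Nx y z; apply: (@loop_mulI _ x); rewrite /= mul_loopT.
by rewrite (nucr y z Nx) -(nucl _ _ Nx) mul_loopT (nucm _ _ Nx) mul_loopT.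
Qed.

Hypothesis extraQ : extra_loop Q.
Local Notation linvM := (linvM extraQ).
Local Notation linvK := (linvK extraQ).
Local Notation mulKl := (mulKl extraQ).
Local Notation mulVKr := (mulVKr extraQ).
Local Notation mulVKl := (mulVKl extraQ).
Local Notation mulKr := (mulKr extraQ).
Local Notation flexible := (flexible extraQ).
Local Notation linv_mul := (linv_mul extraQ).

Lemma right_nuclear_nucleus a :
  (forall x y, x * y * a = x * (y * a)) -> a \in N.
Proof.
move=> nucR; apply/nucleusP; split=> // x y.
  exact: right_nuclear_left.
exact: right_nuclear_middle.
Qed.

Lemma sq_nucleus x : x * x \in N.
Proof. by apply: right_nuclear_nucleus => y z; apply: sq_right_nuclear. Qed.

Lemma nucleusV a : a \in N -> linv a \in N.
Proof.
move=> Na; apply: right_nuclear_nucleus => x y.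
by rewrite -{1}(mulVKr a y) -(nucr _ _ Na) mulKr.
Qed.

Lemma sq_mul x y : x * x * y = x * (x * y).
Proof.
apply: (@loop_mulI _ (linv x)); rewrite /= mulKl.
by rewrite -(nucm _ _ (sq_nucleus x)) mulKl.
Qed.

(** Conjugation preserves the nucleus because squares are nuclear:
    [T_x a = x^-2 a^-1 (ax)^2]. *)
Lemma nucleusT x a : a \in N -> loopT x a \in N.
Proof.
move=> Na.
have -> : loopT x a = linv (x * x) * (linv a * ((a * x) * (a * x))).
  rewrite (nucl x _ Na) mulKl.
  by apply: (@loop_mulI _ (x * x)); rewrite /= mulVKl sq_mul mul_loopT.
apply: nucleusM; first exact/nucleusV/sq_nucleus.
by apply: nucleusM; [apply: nucleusV | apply: sq_nucleus].
Qed.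

Lemma ldivE x y : ldiv x y = linv x * y.
Proof. by apply: (@loop_mulI _ x); rewrite /= mul_ldiv mulVKl. Qed.

Lemma rdivE x y : rdiv x y = y * linv x.
Proof. by apply: (@loop_mulIr _ x); rewrite /= mul_rdiv mulVKr. Qed.

(** In an inverse property loop both divisions are multiplications by an
    inverse. *)
Lemma subloopP (S : {set Q}) :
  reflect [/\ 1 \in S, {in S &, forall a b, a * b \in S}
            & {in S, forall a, linv a \in S}] (subloop S).
Proof.
apply: (iffP andP) => -[S1 clS].
  have cl a b : a \in S -> b \in S ->
      [/\ a * b \in S, ldiv a b \in S & rdiv a b \in S].
    move=> Sa Sb; have /forall_inP/(_ a Sa)/forall_inP/(_ b Sb) := clS.
    by case/and3P.
  by split=> // [a b Sa Sb | a Sa]; [case: (cl a b) | case: (cl a 1)].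
move=> SV; split=> //; apply/forall_inP=> a Sa; apply/forall_inP=> b Sb.
by rewrite ldivE rdivE !clS ?SV.
Qed.

Lemma nucleus_subloop : subloop N.
Proof.
by apply/subloopP; split; [exact: nucleus1 | exact: nucleusM | exact: nucleusV].
Qed.

Lemma nucleus_nuclear_normal : nuclear_normal N.
Proof.
by split=> // [|x b Nb]; [exact: nucleus_subloop | exact: nucleusT].
Qed.

Section Congruence.
Variable B : {set Q}.
Hypothesis nB : nuclear_normal B.
Local Notation "x =~ y" := (cong B x y) (at level 70).

Lemma nuclear_normal_nucleus b : b \in B -> b \in N.
Proof. by case: nB => /subsetP sBN _ _; apply: sBN. Qed.

Let B1 : 1 \in B. Proof. by case: nB => _ /subloopP[]. Qed.
Let BM a b : a \in B -> b \in B -> a * b \in B.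
Proof. by case: nB => _ /subloopP[_ BM _] _; apply: BM. Qed.
Let BV a : a \in B -> linv a \in B.
Proof. by case: nB => _ /subloopP[_ _ BV] _; apply: BV. Qed.
Let BT x b : b \in B -> loopT x b \in B.
Proof. by case: nB => _ _; apply. Qed.

Lemma congP x y : reflect (exists2 b, b \in B & y = x * b) (x =~ y).
Proof.
apply: (iffP idP) => [xy | [b Bb ->]]; last by rewrite /cong ldiv_mul.
by exists (ldiv x y); rewrite ?mul_ldiv.
Qed.

Lemma cong_refl x : x =~ x.
Proof. by apply/congP; exists 1; rewrite ?mulg1. Qed.

Lemma cong_sym x y : (x =~ y) = (y =~ x).
Proof.
suff sym u v : u =~ v -> v =~ u by apply/idP/idP; apply: sym.
case/congP=> b Bb ->; apply/congP; exists (linv b); first exact: BV.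
by rewrite mulKr.
Qed.

Lemma cong_trans y x z : x =~ y -> y =~ z -> x =~ z.
Proof.
case/congP=> a Ba -> /congP[b Bb ->]; apply/congP; exists (a * b).
  exact: BM.
by rewrite (nucm _ _ (nuclear_normal_nucleus Ba)).
Qed.

Lemma congMl y x x' : x =~ x' -> x * y =~ x' * y.
Proof.
case/congP=> b Bb ->; apply/congP; exists (loopT y b); first exact: BT.
rewrite (nucr _ _ (nuclear_normal_nucleus (BT y Bb))) mul_loopT.
by rewrite (nucm _ _ (nuclear_normal_nucleus Bb)).
Qed.

Lemma congMr x y y' : y =~ y' -> x * y =~ x * y'.
Proof.
case/congP=> b Bb ->; apply/congP; exists b => //.
by rewrite (nucr _ _ (nuclear_normal_nucleus Bb)).
Qed.

Lemma congM x x' y y' : x =~ x' -> y =~ y' -> x * y =~ x' * y'.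
Proof. by move=> xx' yy'; apply: cong_trans (congMl y xx') (congMr x' yy'). Qed.

End Congruence.

Local Notation "x =~ y" := (cong N x y) (at level 70).
Let nN := nucleus_nuclear_normal.

(** * The quotient by the nucleus is an elementary abelian 2-group *)

Lemma congV x : linv x =~ x.
Proof.
by apply/congP; exists (x * x); rewrite ?sq_nucleus // mulKl.
Qed.

(** As for groups of exponent 2: [xy] is congruent to its inverse
    [y^-1 x^-1]. *)
Lemma congC x y : x * y =~ y * x.
Proof.
apply: (cong_trans nN (y := linv (x * y))); first by rewrite cong_sym ?congV.
by rewrite linvM; apply: congM => //; apply: congV.
Qed.

Lemma cong_loopT x y t : x * t = y * x -> t =~ y.
Proof.
move=> xt; rewrite -(mulKl x t) -(mulKl x y) xt.
by apply: congMr => //; apply: congC.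
Qed.

(** [cc_right] reads [(yz)x = (yx)z] modulo [N], which together with
    commutativity is associativity. *)
Lemma congA x y z : x * y * z =~ x * (y * z).
Proof.
have xtz : x * loopT x z = z * x := mul_loopT x z.
apply: (cong_trans nN (y := y * z * x)); last exact: congC.
rewrite (cc_right extraQ y xtz); apply: congM => //; first exact: congC.
by rewrite (cong_sym nN); apply: (cong_loopT xtz).
Qed.

(** * Associators are central involutions of the nucleus *)

Lemma assocE x y z : x * (y * z) * assoc x y z = x * y * z.
Proof. exact: mul_ldiv. Qed.

Lemma assoc_eq x y z a : x * (y * z) * a = x * y * z -> assoc x y z = a.
Proof. by rewrite /assoc => <-; rewrite ldiv_mul. Qed.

Lemma assoc_nucleus x y z : assoc x y z \in N.
Proof. by have := congA x y z; rewrite cong_sym. Qed.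

Lemma cong_left x y : x =~ y -> exists2 n, n \in N & y = n * x.
Proof.
move=> xy; exists (y * linv x); last by rewrite mulVKr.
have : x * linv x =~ y * linv x by apply: congMl.
by rewrite mul_linv /cong ldivE -{1}[linv 1]mul1g mul_linv mul1g.
Qed.

Lemma assocMl n x y z : n \in N -> assoc (n * x) y z = assoc x y z.
Proof.
move=> Nn; apply: assoc_eq.
by rewrite !(nucl _ _ Nn) assocE.
Qed.

Lemma assoc_congl x x' y z : x =~ x' -> assoc x' y z = assoc x y z.
Proof. by case/cong_left=> n Nn ->; apply: assocMl. Qed.

(** A nuclear factor of [y] can be moved to the right end of [x], and from there
    to the left of [x], since [xN = Nx]; in [assoc_congr], a factor of
    [z] is first moved to [y]. *)
Lemma assoc_congm x y y' z : y =~ y' -> assoc x y' z = assoc x y z.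
Proof.
case/cong_left=> n Nn ->; rewrite -(@assoc_congl x (x * n) y); last first.
  by apply/congP; exists n.
by rewrite /assoc (nucl _ _ Nn) !(nucm _ _ Nn).
Qed.

Lemma assoc_congr x y z z' : z =~ z' -> assoc x y z' = assoc x y z.
Proof.
case/cong_left=> n Nn ->; rewrite -(@assoc_congm x y (y * n) z); last first.
  by apply/congP; exists n.
by rewrite /assoc -(nucr x y Nn) !(nucm _ _ Nn).
Qed.

(** Moving [n] out of [(xy)(zn)] conjugates the associator by [n], whereas it
    depends on [z] only modulo [N]. *)
Lemma assocC n x y z : n \in N -> n * assoc x y z = assoc x y z * n.
Proof.
move=> Nn; have aE : assoc x y (z * n) = assoc x y z.
  by apply: assoc_congr; apply/congP; exists n.
apply: (@loop_mulI _ (x * (y * z))) => /=.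
rewrite -{1}aE -(nucm _ _ Nn) (nucr x _ Nn) (nucr y _ Nn) assocE.
by rewrite -!(nucr _ _ Nn) assocE.
Qed.

(** With [xt = yx], the law [x(tz) = y(xz)] compares the associators of
    [x, t, z] and of [y, x, z], and [t] is congruent to [y] modulo [N]. *)
Lemma assoc_sym12 x y z : assoc x y z = assoc y x z.
Proof.
have xt : x * loopT x y = y * x := mul_loopT x y.
rewrite (assoc_congm x z (cong_loopT xt)); apply: assoc_eq.
by rewrite (cc_left extraQ z xt) assocE xt.
Qed.

Lemma assoc_sym23 x y z : assoc x y z = assoc x z y.
Proof.
have zt : z * loopT z y = y * z := mul_loopT z y.
by rewrite (assoc_congr x z (cong_loopT zt)) /assoc (cc_right extraQ x zt) zt.
Qed.

(** Both sides of the extra law reduce to [x(yz)x] times an associator: on the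
    left [a] appears conjugated by [x], on the right inverted. *)
Lemma assoc_conj x y z : assoc x y z * x = x * linv (assoc x y z).
Proof.
have Na := assoc_nucleus x y z; have NVa := nucleusV Na.
have yzx : y * (z * x) = y * z * x * linv (assoc x y z).
  rewrite -(assocE y z x) (_ : assoc y z x = assoc x y z) ?mulKr //.
  by rewrite assoc_sym23 assoc_sym12.
have := extraQ x y z; rewrite -(assocE x y z) (nucm _ _ Na) yzx.
rewrite -(nucr _ _ NVa) -flexible (nucr _ _ NVa).
exact: (@loop_mulI _ (x * (y * z))).
Qed.

(** Each of [x], [y], [z] inverts [a], hence so does [w = (xy)z].  On the other
    hand [w] centralises [a]: inverting [(xy)z = x(yz) a] produces the
    associator of [z^-1, y^-1, x^-1], which is again [a] because inverses are
    congruent to the elements modulo [N]. *)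
Lemma assoc_sq x y z : assoc x y z * assoc x y z = 1.
Proof.
set a := assoc x y z; have Na : a \in N := assoc_nucleus x y z.
have NVa := nucleusV Na; pose w := x * y * z.
have ax : a * x = x * linv a := assoc_conj x y z.
have ay : a * y = y * linv a by rewrite /a assoc_sym12 assoc_conj.
have az : a * z = z * linv a.
  by rewrite /a assoc_sym23 assoc_sym12 assoc_conj.
have Vay : linv a * y = y * a.
  by rewrite -{1}(mulVKr a y) -(nucl _ _ NVa) -ay mulKl.
have aw : a * w = w * linv a.
  rewrite /w -!(nucl _ _ Na) ax (nucm _ _ NVa) Vay -(nucr _ _ Na).
  by rewrite (nucm _ _ Na) az (nucr _ _ NVa).
have aVw : a * linv w = linv w * a.
  have aE : assoc (linv z) (linv y) (linv x) = a.
    rewrite -(assoc_congl _ _ (congV z)) -(assoc_congm _ _ (congV y)).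
    rewrite -(assoc_congr _ _ (congV x)).
    by rewrite assoc_sym23 assoc_sym12 assoc_sym23.
  have wE : linv w = linv a * (linv w * assoc (linv z) (linv y) (linv x)).
    have {1}-> : w = x * (y * z) * a by rewrite assocE.
    by rewrite /w !linvM assocE.
  by rewrite {1}wE mulVKl aE.
have wa : w * a = a * w.
  by rewrite -{1}(mulVKr w (w * a)) (nucm _ _ Na) aVw mulVKl.
have aVa : a = linv a := @loop_mulI _ w _ _ (etrans wa aw).
by rewrite {2}aVa mul_linv.
Qed.

(** Preferred to the subgroup generated by the associators, since here closure
    under products and under every [T_x] follows from the defining
    conditions. *)
Definition central_involutions : {set Q} :=
  [set a in N | (a * a == 1) && [forall n in N, n * a == a * n]].

Lemma central_involutionsP a :
  reflect [/\ a \in N, a * a = 1 & {in N, forall n, n * a = a * n}]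
          (a \in central_involutions).
Proof.
rewrite [a \in central_involutions]inE.
apply: (iffP and3P) => [[Na /eqP aa /forall_inP cNa] | [Na aa cNa]].
  by split=> // n /cNa/eqP.
by split=> //; [apply/eqP | apply/forall_inP=> n /cNa->].
Qed.

Lemma assoc_central_involutions x y z : assoc x y z \in central_involutions.
Proof.
apply/central_involutionsP; split; [exact: assoc_nucleus|exact: assoc_sq|].
by move=> n; apply: assocC.
Qed.

Lemma central_involutions_nuclear_normal : nuclear_normal central_involutions.
Proof.
split; first by apply/subsetP=> a /central_involutionsP[].
- apply/subloopP; split.
  + apply/central_involutionsP.
    by split=> [||n _]; rewrite ?nucleus1 ?mulg1 ?mul1g.
  + move=> a b /central_involutionsP[Na aa cNa].
    move=> /central_involutionsP[Nb bb cNb].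
    apply/central_involutionsP; split=> [||n Nn]; first exact: nucleusM.
      by rewrite (nucl _ _ Na) -(nucl a b Nb) cNa // (nucl _ _ Na) bb mulg1.
    by rewrite -(nucl a b Nn) cNa // (nucl _ _ Na) cNb // -(nucl _ _ Na).
  + move=> a Aa; have /central_involutionsP[_ aa _] := Aa.
    by rewrite -(linv_uniq aa).
move=> x a /central_involutionsP[Na aa cNa]; have NTa := nucleusT x Na.
have xTa : x * loopT x a = a * x := mul_loopT x a.
apply/central_involutionsP; split=> // [|n Nn]; apply: (@loop_mulI _ x) => /=.
  rewrite -(nucr _ _ NTa) xTa (nucl _ _ Na) xTa -(nucl _ _ Na).
  by rewrite aa mul1g mulg1.
(* [T_x a] commutes with [n] because [a] commutes with [m = x n x^-1]. *)
have [|m Nm xn] := @cong_left x (x * n); first by apply/congP; exists n.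
rewrite -(nucm _ _ Nn) xn (nucl _ _ Nm) xTa -(nucl a x Nm) cNa //.
by rewrite (nucl _ _ Na) -xn -(nucr _ _ Nn) -xTa (nucr _ _ Nn).
Qed.

End Nucleus.

(** * Quotients that are groups *)

(** The group is carried by the image of [D] under [f], the operations
    being computed on chosen representatives in [D]; the hypotheses say that the
    kernel of [f] is a congruence on [D] with associative quotient. *)
Lemma group_of_congruence (Q : finLoopType) (D : {set Q}) (T : finType)
    (f : Q -> T) :
    subloop D ->
    {in D & &, forall x y z, f (x * y * z) = f (x * (y * z))} ->
    (forall x x' y y', x \in D -> x' \in D -> y \in D -> y' \in D ->
       f x = f x' -> f y = f y' -> f (x * y) = f (x' * y')) ->
  exists (G : finGroupType) (h : Q -> G),
    [/\ h @: D = [set: G], {in D &, {morph h : x y / x * y}}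
      & {in D &, forall x y, h x = h y <-> f x = f y}].
Proof.
case/andP=> D1 /forall_inP clD fA fM.
have cl a b : a \in D -> b \in D ->
    [&& a * b \in D, ldiv a b \in D & rdiv a b \in D].
  by move=> Da Db; have /forall_inP/(_ b Db) := clD a Da.
have DM a b : a \in D -> b \in D -> a * b \in D.
  by move=> Da /(cl a b Da)/and3P[].
have Drdiv a : a \in D -> rdiv a 1 \in D.
  by move=> Da; case/and3P: (cl a 1 Da D1).
pose G0 := {t : T | t \in f @: D}.
pose h x : G0 := insubd (exist _ (f 1) (imset_f f D1)) (f x).
have valh x : x \in D -> val (h x) = f x.
  by move=> Dx; rewrite val_insubd imset_f.
have hE x y : x \in D -> y \in D -> h x = h y <-> f x = f y.
  by move=> Dx Dy; rewrite -!valh //; split=> [->|/val_inj].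
pose s (t : G0) := odflt 1 [pick x in D | f x == val t].
have [Ds sK] : (forall t, s t \in D) /\ cancel s h.
  suff sP t : s t \in D /\ f (s t) = val t.
    split=> t; first by case: (sP t).
    by have [Ds fs] := sP t; apply: val_inj; rewrite valh.
  rewrite /s; case: pickP => /= [x /andP[-> /eqP] // | noD].
  by have /imsetP[x Dx tx] := valP t; have := noD x; rewrite /= Dx tx eqxx.
have hA x y z : x \in D -> y \in D -> z \in D ->
    h (x * y * z) = h (x * (y * z)).
  by move=> Dx Dy Dz; apply/hE; rewrite ?DM ?fA.
have hM x x' y y' : x \in D -> x' \in D -> y \in D -> y' \in D ->
    h x = h x' -> h y = h y' -> h (x * y) = h (x' * y').
  move=> Dx Dx' Dy Dy' /(hE _ _ Dx Dx') xx' /(hE _ _ Dy Dy') yy'.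
  by apply/hE; rewrite ?DM //; apply: fM.
pose m t u := h (s t * s u).
have mA : associative m.
  move=> t u v; rewrite /m; transitivity (h (s t * (s u * s v))).
    by apply: hM; rewrite ?sK ?DM ?Ds.
  by rewrite -hA ?Ds //; apply: hM; rewrite ?sK ?DM ?Ds.
have m1 : left_id (h 1) m.
  move=> t; rewrite /m -[RHS]sK -[in RHS](mul1g (s t)).
  by apply: hM; rewrite ?sK ?Ds.
have mV : left_inverse (h 1) (fun t => h (rdiv (s t) 1)) m.
  move=> t; rewrite /m -(mul_rdiv (s t) 1).
  by apply: hM; rewrite ?sK ?Drdiv ?Ds ?mul_rdiv.
pose G : finGroupType := HB.pack G0 (Finite_isGroup.Build G0 mA m1 mV).
exists G, h; split=> //.
  by apply/setP=> t; rewrite inE; apply/imsetP; exists (s t); rewrite ?Ds ?sK.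
by move=> x y Dx Dy; apply: hM; rewrite ?sK ?Ds.
Qed.

(** With [D = Q] this produces [Q/N] and [Q/A]; with [B] trivial it turns a
    subloop [D] of [N] into a group. *)
Lemma nuclear_quotient (Q : finLoopType) (D B : {set Q}) :
    extra_loop Q -> subloop D -> nuclear_normal B ->
    {in D & &, forall x y z, assoc x y z \in B} ->
  exists (G : finGroupType) (h : Q -> G),
    [/\ h @: D = [set: G], {in D &, {morph h : x y / x * y}}
      & {in D &, forall x y, h x = h y <-> cong B x y}].
Proof.
move=> extraQ sD nB DA.
pose coset x := [set y | cong B x y].
have cosetE x y : coset x = coset y <-> cong B x y.
  split=> [eqxy | xy].
    have := cong_refl extraQ nB y.
    by rewrite -[cong B y y]in_set -/(coset y) -eqxy inE.
  apply/setP=> z; rewrite !inE.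
  apply/idP/idP; apply: (cong_trans extraQ nB) => //.
  by rewrite (cong_sym extraQ nB).
have [||G [h [hD hM hE]]] := @group_of_congruence _ _ _ coset sD.
- move=> x y z Dx Dy Dz; apply/cosetE; rewrite (cong_sym extraQ nB); exact: DA.
- move=> x x' y y' _ _ _ _ /cosetE xx' /cosetE yy'.
  by apply/cosetE/(congM extraQ nB).
exists G, h; split=> // x y Dx Dy.
exact: iff_trans (hE x y Dx Dy) (cosetE x y).
Qed.

(** * Transferring the Sylow theorems along a quotient *)

Section NuclearQuotient.
Variables (Q : finLoopType) (D B : {set Q}) (G : finGroupType) (h : Q -> G).
Hypothesis extraQ : extra_loop Q.
Hypotheses (sD : subloop D) (sBD : B \subset D).
Hypothesis hD : h @: D = [set: G].
Hypothesis hM : {in D &, {morph h : x y / x * y}}.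
Hypothesis hE : {in D &, forall x y, h x = h y <-> cong B x y}.
Implicit Types (S : {set Q}) (P : {group G}).

Lemma card_fibers S :
  subloop S -> S \subset D -> #|S| = (#|h @: S| * #|S :&: B|)%N.
Proof.
move=> /(subloopP extraQ)[S1 SM SV] sSD.
rewrite -sum1_card (partition_big_imset h) /= -sum_nat_const.
apply: eq_bigr => _ /imsetP[x Sx ->]; rewrite sum1dep_card.
rewrite -[#|S :&: B|](card_imset _ (@loop_mulI _ x)); congr #|pred_of_set _|.
apply/setP=> y; rewrite inE; apply/andP/imsetP=> [[Sy /eqP hyx]|[b SBb ->]].
  have xy : cong B x y by apply/hE; rewrite ?(subsetP sSD).
  exists (ldiv x y); last by rewrite mul_ldiv.
  by rewrite inE -/(cong B x y) xy andbT (ldivE extraQ) SM ?SV.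
have [Sb Bb] := setIP SBb; split; first exact: SM.
by apply/eqP/esym/hE; rewrite ?(subsetP sSD) ?SM //; apply/congP; exists b.
Qed.

Lemma image_group_set S : subloop S -> S \subset D -> group_set (h @: S).
Proof.
move=> /(subloopP extraQ)[S1 SM SV] sSD; apply/group_setP; split.
  apply/imsetP; exists 1 => //; apply: (@mulgI _ (h 1)).
  by rewrite -hM ?mulg1 // (subsetP sSD).
move=> _ _ /imsetP[x Sx ->] /imsetP[y Sy ->].
by rewrite -hM ?(subsetP sSD) // imset_f // SM.
Qed.

Definition preim_subloop (P : {set G}) : {set Q} := D :&: h @^-1: P.

Lemma morph1 : h 1 = 1.
Proof.
have [D1 _ _] := subloopP extraQ _ sD.
by apply: (@mulgI _ (h 1)); rewrite -hM ?mulg1.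
Qed.

Lemma preim_subloopP P : subloop (preim_subloop P).
Proof.
have [D1 DM DV] := subloopP extraQ _ sD.
apply/(subloopP extraQ); split=> [|x y|x]; rewrite !inE ?D1 ?morph1 ?group1 //.
  by move=> /andP[Dx Px] /andP[Dy Py]; rewrite DM // hM // groupM.
move=> /andP[Dx Px]; rewrite DV //=.
rewrite (_ : h (linv x) = (h x)^-1) ?groupV //.
by apply: (@mulgI _ (h x)); rewrite -hM ?DV // mul_linv mulgV morph1.
Qed.

Lemma preim_subloopK P : h @: preim_subloop P = P.
Proof.
apply/setP=> g; apply/imsetP/idP => [[x]|Pg].
  by rewrite !inE => /andP[_ Px] ->.
have : g \in h @: D by rewrite hD inE.
by case/imsetP=> x Dx gx; exists x; rewrite // !inE Dx -gx.
Qed.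

Lemma card_preim_subloop P : #|preim_subloop P| = (#|P| * #|B|)%N.
Proof.
rewrite (card_fibers (preim_subloopP P)) ?subsetIl // preim_subloopK.
congr (_ * _)%N; apply/eq_card=> b; rewrite !inE andb_idl // => Bb.
have [D1 _ _] := subloopP extraQ _ sD.
rewrite (subsetP sBD) // (_ : h b = 1) ?group1 // -morph1.
apply/esym/hE => //; first exact: (subsetP sBD).
by apply/congP; exists b; rewrite ?mul1g.
Qed.

(** [D] holds all the [p]-subloops and the whole [p]-part of the order of [Q],
    and the kernel [B] is a [p]-group; so [p]-subloops of [Q] and [p]-subgroups
    of [D/B] control each other. *)
Section Sylow.
Variables (p m r : nat).
Hypothesis p_pr : prime p.
Hypothesis cardN : #|nucleus Q| = (p ^ m * r)%N.
Hypothesis sND : nucleus Q \subset D.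
Hypothesis pB : p.-nat #|B|.
Hypothesis pD : forall S, p_subloop p S -> S \subset D.
Hypothesis cardD : (#|Q|`_p = #|D|`_p)%N.
Hypothesis pGN : p.-nat #|[set: G] : h @: nucleus Q|.

Lemma card_preim_Sylow P :
  p.-Sylow([set: G]) P -> #|preim_subloop P| = (#|Q|`_p)%N.
Proof.
move=> sylP; rewrite card_preim_subloop (card_Hall sylP) cardD.
have -> : D = preim_subloop [set: G].
  by apply/setP=> x; rewrite !inE andbT.
rewrite (card_preim_subloop [group of [set: G]]) partnM ?cardG_gt0 //.
  by rewrite (part_pnat_id pB).
by case/andP: pB.
Qed.

Lemma p_subloop_preim_Sylow S :
    p_subloop p S ->
  exists2 P : {group G}, p.-Sylow([set: G]) P & S \subset preim_subloop P.
Proof.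
move=> pS; have sSD := pD pS; have /andP[sS p_S] := pS.
pose K := Group (image_group_set sS sSD).
have [|P sylP sKP] := @Sylow_superset p _ [group of [set: G]] K (subsetT _).
  by move: p_S; rewrite (card_fibers sS sSD) pnatM => /andP[].
exists P => //; apply/subsetP=> x Sx.
by rewrite !inE (subsetP sSD) // (subsetP sKP) // imset_f.
Qed.

(** A Sylow [p]-subloop lies in the preimage of a Sylow [p]-subgroup, and the
    two have the same order. *)
Lemma Syl_preim :
  Syl p Q = [set preim_subloop P | P : {group G} in 'Syl_p([set: G])].
Proof.
apply/setP=> S; apply/idP/imsetP=> [|[P]]; rewrite inE; last first.
  by move=> sylP ->; rewrite inE preim_subloopP card_preim_Sylow //=.
move=> /andP[sS /eqP cardS].
have [|P sylP sSP] := @p_subloop_preim_Sylow S.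
  by rewrite /p_subloop sS cardS part_pnat.
exists P; first by rewrite inE.
by apply/eqP; rewrite eqEcard sSP card_preim_Sylow // cardS leqnn.
Qed.

Lemma card_Syl : #|Syl p Q| = #|'Syl_p([set: G])|.
Proof.
rewrite Syl_preim card_imset // => P1 P2 eqP12.
by apply: val_inj; rewrite /= -(preim_subloopK P1) eqP12 preim_subloopK.
Qed.

Let sN := nucleus_subloop extraQ.
Let H := Group (image_group_set sN sND).

Lemma morphT x y : x \in D -> y \in D -> loopT x y \in D ->
  h (loopT x y) = h y ^ h x.
Proof.
move=> Dx Dy DTy; apply: (@mulgI _ (h x)).
by rewrite -hM // mul_loopT hM // -conjgC.
Qed.

(** The number of Sylow subgroups is prime to [p] and divides [|D/B|], which is
    [|h(N)|], a divisor of [p^m r], times a power of [p]. *)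
Lemma card_Syl_dvd_r : #|Syl p Q| %| r.
Proof.
have co_p : coprime #|Syl p Q| p.
  rewrite coprime_sym prime_coprime // card_Syl /dvdn.
  by rewrite (card_Syl_mod [group of [set: G]] p_pr).
have : #|Syl p Q| %| #|[set: G]|.
  by rewrite card_Syl (card_Syl_dvd p [group of [set: G]]).
rewrite -(@Lagrange _ [group of [set: G]] H (subsetT _)).
rewrite Gauss_dvdl; last first.
  have [k ->] := p_natP pGN; exact: coprimeXr.
move/dvdn_trans/(_ (dvdn_mulr #|nucleus Q :&: B| (dvdnn _))).
rewrite /= -(card_fibers sN sND) cardN.
by rewrite Gauss_dvdr // coprimeXr.
Qed.

(** If [g] conjugates [P1] to [P2], write [g = a (h n)] with [a] in [P1] and [n]
    nuclear: [P1] and [h(N)] have coprime indices, so their product is the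
    whole group. *)
Lemma Sylow_nuclear_conj P1 P2 :
    p.-Sylow([set: G]) P1 -> p.-Sylow([set: G]) P2 ->
  exists2 x, x \in nucleus Q & P2 :=: P1 :^ h x.
Proof.
move=> syl1 syl2.
have P1H : P1 * H = [set: G].
  apply: (@coprime_index_mulG _ [group of [set: G]]); rewrite ?subsetT //.
  rewrite coprime_sym (pnat_coprime pGN) //.
  by case/and3P: syl1.
have [g _ P2g] := Sylow_trans syl1 syl2.
have : g \in P1 * H by rewrite P1H inE.
case/mulsgP=> a _ P1a /imsetP[n Nn ->] gE; exists n => //.
by rewrite P2g gE conjsgM (conjGid P1a).
Qed.

Lemma loopT_preim P x :
  x \in nucleus Q -> loopT x @: preim_subloop P = preim_subloop (P :^ h x).
Proof.
move=> Nx; apply/eqP; rewrite eqEcard card_imset; last exact: loopT_inj.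
rewrite !card_preim_subloop cardJg leqnn andbT.
have Dx := subsetP sND x Nx.
apply/subsetP=> _ /imsetP[y + ->]; rewrite !inE => /andP[Dy Py].
have [D1 DM DV] := subloopP extraQ _ sD.
have DTy : loopT x y \in D by rewrite (loopTE extraQ) ?DM ?DV.
by rewrite DTy morphT // memJ_conjg.
Qed.

Lemma Sylow_transfer :
  [/\ exists k : nat, #|Syl p Q| = (1 + k * p)%N /\ (1 + k * p %| r)%N,
      forall S : {set Q}, p_subloop p S ->
        exists P : {set Q}, P \in Syl p Q /\ S \subset P
    & forall P1 P2 : {set Q}, P1 \in Syl p Q -> P2 \in Syl p Q ->
        (exists x : Q, x \in nucleus Q /\ loopT x @: P1 = P2)
        /\ subloop_isog P1 P2].
Proof.
split.
- exists (#|Syl p Q| %/ p)%N.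
  suff <- : #|Syl p Q| = (1 + #|Syl p Q| %/ p * p)%N.
    by rewrite card_Syl_dvd_r.
  rewrite {1}(divn_eq #|Syl p Q| p) addnC; congr (_ + _)%N.
  by rewrite card_Syl (card_Syl_mod [group of [set: G]] p_pr).
- move=> S /p_subloop_preim_Sylow[P sylP sSP]; exists (preim_subloop P).
  by split=> //; rewrite Syl_preim; apply/imsetP; exists P; rewrite ?inE.
move=> _ _ /[!Syl_preim] /imsetP[P1 + ->] /imsetP[P2 + ->].
rewrite !inE => syl1 syl2; have [x Nx P2x] := Sylow_nuclear_conj syl1 syl2.
have TP : loopT x @: preim_subloop P1 = preim_subloop P2.
  by rewrite P2x loopT_preim.
split; first by exists x.
exists (loopT x); split=> // [|y z _ _]; last exact: loopT_morph.
by move=> y z _ _; apply: loopT_inj.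
Qed.

End Sylow.
End NuclearQuotient.

(** * The two quotients *)

Lemma involutive_2group (G : finGroupType) :
  (forall g : G, g * g = 1) -> 2.-nat #|[set: G]|.
Proof.
move=> sq1; rewrite -/(pgroup _ _) -(pnat_exponent _ [group of [set: G]]).
apply: (@pnat_dvd _ 2) => //; apply/exponentP=> g _; exact: sq1.
Qed.

Lemma trivial_nuclear_normal (Q : finLoopType) :
  extra_loop Q -> nuclear_normal [set 1 : Q].
Proof.
move=> extraQ; split; first by rewrite sub1set nucleus1.
  apply/(subloopP extraQ); split=> [|a b|a]; rewrite !inE //.
    by move=> /eqP-> /eqP->; rewrite mulg1.
  by move=> /eqP->; rewrite -[linv 1]mul1g mul_linv.
by move=> x b; rewrite !inE => /eqP->; rewrite (loopTE extraQ) mul1g linv_mul.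
Qed.

Lemma nuclear_assoc1 (Q : finLoopType) (x y z : Q) :
  x \in nucleus Q -> assoc x y z \in [set 1 : Q].
Proof.
by move=> Nx; rewrite inE; apply/eqP/assoc_eq; rewrite mulg1 (nucl _ _ Nx).
Qed.

Lemma card_central_involutions (Q : finLoopType) :
  extra_loop Q -> 2.-nat #|central_involutions Q|.
Proof.
move=> extraQ; set A := central_involutions Q.
have [_ sA _] := central_involutions_nuclear_normal extraQ.
have n1 := trivial_nuclear_normal extraQ.
have [|G [h [hA hM hE]]] := nuclear_quotient extraQ sA n1.
  move=> x y z /central_involutionsP[Nx _ _] _ _; exact: nuclear_assoc1.
have A1 : 1 \in A by have [] := subloopP extraQ _ sA.
rewrite (card_fibers extraQ hE sA) // hA.
have -> : A :&: [set 1 : Q] = [set 1 : Q] by apply/setIidPr; rewrite sub1set.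
rewrite cards1 muln1; apply: involutive_2group => g.
have /imsetP[x Ax ->] : g \in h @: A by rewrite hA inE.
have [_ xx _] := central_involutionsP _ Ax.
by rewrite -hM // xx (morph1 extraQ sA hM).
Qed.

Lemma setT_subloop (Q : finLoopType) : extra_loop Q -> subloop [set: Q].
Proof.
by move=> extraQ; apply/(subloopP extraQ); split=> [|a b _ _|a _]; rewrite inE.
Qed.

Lemma nucleus_quotient (Q : finLoopType) :
    extra_loop Q ->
  exists (G : finGroupType) (h : Q -> G),
    [/\ 2.-nat #|[set: G]|, h @: [set: Q] = [set: G], {morph h : x y / x * y}
      & forall x y, h x = h y <-> cong (nucleus Q) x y].
Proof.
move=> extraQ; have sQ := setT_subloop extraQ.
have nN := nucleus_nuclear_normal extraQ.
have [|G [h [hQ hM hE]]] := nuclear_quotient extraQ sQ nN.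
  by move=> x y z _ _ _; apply: assoc_nucleus.
have hMT : {morph h : x y / x * y} by move=> x y; rewrite hM ?inE.
have hET x y : h x = h y <-> cong (nucleus Q) x y by apply: hE; rewrite inE.
exists G, h; split=> //; apply: involutive_2group => g.
have /imsetP[x _ ->] : g \in h @: [set: Q] by rewrite hQ inE.
rewrite -hMT -(morph1 extraQ sQ hM); apply/esym/hET.
by apply/congP; exists (x * x); rewrite ?sq_nucleus ?mul1g.
Qed.

Lemma nucleus_index (Q : finLoopType) :
  extra_loop Q -> exists2 k, 2.-nat k & #|Q| = (k * #|nucleus Q|)%N.
Proof.
move=> extraQ; have [G [h [G2 hQ hM hE]]] := nucleus_quotient extraQ.
have sQ := setT_subloop extraQ; have nN := nucleus_nuclear_normal extraQ.
exists #|[set: G]| => //.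
rewrite -cardsT -[in RHS]hQ -(setTI (nucleus Q)).
by apply: (card_fibers extraQ _ sQ (subxx _)) => x y _ _; apply: hE.
Qed.

(** The image in the 2-group [Q/N] is both a [p]-group and a 2-group. *)
Lemma odd_p_subloop_nucleus (Q : finLoopType) (p : nat) (S : {set Q}) :
    extra_loop Q -> prime p -> p != 2%N -> p_subloop p S ->
  S \subset nucleus Q.
Proof.
move=> extraQ p_pr p_odd /andP[sS pS].
have [G [h [G2 hQ hM hE]]] := nucleus_quotient extraQ.
have sQ := setT_subloop extraQ; have nN := nucleus_nuclear_normal extraQ.
have hE' : {in [set: Q] &, forall x y, h x = h y <-> cong (nucleus Q) x y}.
  by move=> x y _ _; apply: hE.
have hM' : {in [set: Q] &, {morph h : x y / x * y}}.
  by move=> x y _ _; apply: hM.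
pose K := Group (image_group_set extraQ hM' sS (subsetT S)).
have pK : p.-nat #|K|.
  move: pS; rewrite (card_fibers extraQ hE' sS (subsetT S)) pnatM.
  by case/andP.
have /card1_trivg K1 : #|K| = 1%N.
  apply: (@pnat_1 2); first exact: pnat_dvd (cardSg (subsetT K)) G2.
  by apply: sub_in_pnat pK => q _ /eqP->.
apply/subsetP=> x Sx; have: h x \in K by apply: imset_f.
rewrite K1 inE -(morph1 extraQ sQ hM') => /eqP/esym/hE.
by case/(congP)=> n Nn ->; rewrite mul1g.
Qed.

Local Close Scope group_scope.

Theorem theorem4p5 (Q : finLoopType) (p m r : nat)
    (extraQ : extra_loop Q) (p_prime : prime p) (p_ndvd_r : ~~ (p %| r))
    (cardN : #|nucleus Q| = p ^ m * r) :
  [/\ exists k : nat, #|Syl p Q| = 1 + k * p /\ 1 + k * p %| r,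
      forall S : {set Q}, p_subloop p S ->
        exists P : {set Q}, P \in Syl p Q /\ S \subset P
    & forall P1 P2 : {set Q}, P1 \in Syl p Q -> P2 \in Syl p Q ->
        (exists x : Q, x \in nucleus Q /\ loopT x @: P1 = P2)
        /\ subloop_isog P1 P2].
Proof.
have sN := nucleus_subloop extraQ; have [k k2 cardQ] := nucleus_index extraQ.
have [p2 | p_odd] := eqVneq p 2; last first.
  (* For odd [p], the group is the nucleus itself. *)
  have n1 := trivial_nuclear_normal extraQ.
  have [|G [h [hN hM hE]]] := nuclear_quotient extraQ sN n1.
    by move=> x y z Nx _ _; apply: nuclear_assoc1.
  apply: (Sylow_transfer extraQ sN _ hN hM hE p_prime cardN) => //.
  - by rewrite sub1set nucleus1.
  - by rewrite cards1.
  - by move=> S; apply: odd_p_subloop_nucleus.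
  - have [k_gt0 N_gt0] : 0 < k /\ 0 < #|nucleus Q|.
      by split; [case/andP: k2 | apply/card_gt0P; exists 1%g; apply: nucleus1].
    rewrite cardQ partnM // part_p'nat ?mul1n //.
    by apply: sub_in_pnat k2 => q _ /eqP->; rewrite !inE eq_sym.
  - by rewrite hN (indexgg [group of [set: G]]).
(* Now [p = 2], and the Sylow theory is that of [Q/A]. *)
have nA := central_involutions_nuclear_normal extraQ; have [sAN _ _] := nA.
have sQ := setT_subloop extraQ.
have [|G [h [hQ hM hE]]] := nuclear_quotient extraQ sQ nA.
  by move=> x y z _ _ _; apply: assoc_central_involutions.
have A2 := card_central_involutions extraQ.
apply: (Sylow_transfer extraQ sQ _ hQ hM hE p_prime cardN); rewrite ?subsetT //.
- by rewrite p2.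
- by rewrite cardsT.
have sNQ := subsetT (nucleus Q).
pose H := Group (image_group_set extraQ hM sN sNQ).
(* [|Q/A : N/A| = |Q : N|], a power of 2. *)
have := card_fibers extraQ hE sQ (subsetT _).
rewrite cardsT cardQ hQ setTI (card_fibers extraQ hE sN sNQ) (setIidPr sAN).
rewrite -(@Lagrange _ [group of [set: G]] H (subsetT _)) mulnA => /eqP.
rewrite eqn_pmul2r; last by case/andP: A2.
rewrite mulnC eqn_pmul2l ?(cardG_gt0 H) // p2 => /eqP <-; exact: k2.
Qed.
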